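(* Let $\lambda$ be an infinite cardinal. For every coloring $c:[\lambda^+]^2\to\lambda$ there exists a coloring $c^+:[\lambda^+]^2\to\lambda^+$ such that for every cardinal $\mu\le\lambda$, every partition $p:[\lambda^+]^2\to\mu$, and every cardinal $\chi$ with $\lambda^{<\chi}=\lambda$: (1) if $c$ witnesses $\mathrm{pr}_1(\lambda^+,\lambda^+,\lambda,\chi)_p$ then $c^+$ witnesses $\mathrm{pr}_1(\lambda^+,\lambda^+,\lambda^+,\chi)_p$; (2) if $c$ witnesses $\mathrm{pr}_1(\lambda^+,\lambda^+\circledast\lambda^+,\lambda,\chi)_p$ then $c^+$ witnesses $\mathrm{pr}_1(\lambda^+,\lambda^+\circledast\lambda^+,\lambda^+,\chi)_p$; (3) for every cardinal $\nu$ with $\operatorname{cf}([\lambda]^\nu,\subseteq)\le\lambda$, if $c$ witnesses $\mathrm{pr}_1(\lambda^+,\lambda\circledast\lambda^+/\nu\circledast\lambda^+,\lambda,\chi)_p$ then $c^+$ witnesses $\mathrm{pr}_1(\lambda^+,\lambda\circledast\lambda^+/\nu\circledast\lambda^+,\lambda^+,\chi)_p$.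
   Context: $[\kappa]^2$ denotes the set of pairs $(\alpha,\beta)$ with $\alpha<\beta<\kappa$; a partition is any function $p:[\kappa]^2\to\mu$. $\operatorname{cf}([\lambda]^\nu,\subseteq)$ is the least size of a family $\mathcal F$ of $\nu$-sized subsets of $\lambda$ such that every $\nu$-sized subset of $\lambda$ is contained in a member of $\mathcal F$. For an ordinal $\sigma$, $[\kappa]^\sigma$ is the set of subsets of $\kappa$ of order type $\sigma$; $a<b$ means every element of $a$ is below every element of $b$; $[\mathcal A]^{\nu'}$ is the set of subfamilies of $\mathcal A$ of size $\nu'$. Given $p:[\kappa]^2\to\mu$, a coloring $c:[\kappa]^2\to\theta$ witnesses: - $\mathrm{pr}_1(\kappa,\kappa,\theta,\chi)_p$ iff for every ordinal $\sigma<\chi$, every pairwise disjoint $\mathcal A\subseteq[\kappa]^\sigma$ of size $\kappa$ and every $\tau:\mu\to\theta$ there are $a,b\in\mathcal A$, $a<b$, with $c(\alpha,\beta)=\tau(p(\alpha,\beta))$ for all $\alpha\in a,\beta\in b$; - $\mathrm{pr}_1(\kappa,\nu\circledast\kappa/\nu'\circledast\kappa,\theta,\chi)_p$ iff for every ordinal $\sigma<\chi$ and every two families $\mathcal A,\mathcal B\subseteq[\kappa]^\sigma$, each pairwise disjoint, with $|\mathcal A|=\nu$, $|\mathcal B|=\kappa$, there is $\mathcal A'\in[\mathcal A]^{\nu'}$ such that for every $\tau:\mu\to\theta$ there are $a\in\mathcal A'$, $b\in\mathcal B$, $a<b$, with $c(\alpha,\beta)=\tau(p(\alpha,\beta))$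 for all $\alpha\in a,\beta\in b$; - $\mathrm{pr}_1(\kappa,\nu\circledast\kappa,\theta,\chi)_p$ is the case $\nu'=\nu$ of the previous item. *)

(* Defs.v *)
From HB Require Import structures.
From mathcomp Require Import all_boot all_order all_algebra.
From mathcomp Require Import boolp classical_sets functions cardinality.
Set Implicit Arguments. Unset Strict Implicit. Unset Printing Implicit Defensive.
Local Open Scope classical_set_scope.
Local Open Scope card_scope.

Definition is_wo (S : Type) (r : S -> S -> Prop) : Prop :=
  (forall x, ~ r x x) /\ (forall x y z, r x y -> r y z -> r x z) /\
  (forall x y, x = y \/ r x y \/ r y x) /\ well_founded r.

Definition card_lt T U (A : set T) (B : set U) : Prop := A #<= B /\ ~ (B #<= A).

(* (K, ltK) is (an isomorphic copy of) the ordinal lambda^+ where lambda = |L|: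
   a well-order of cardinality > |L| all of whose proper initial segments
   have cardinality <= |L|. *)
Definition is_succ_card (L K : Type) (ltK : K -> K -> Prop) : Prop :=
  is_wo ltK /\ card_lt [set: L] [set: K] /\
  (forall a : K, [set b | ltK b a] #<= [set: L]).

(* lambda^{<chi} = lambda, lambda = |L|, chi = |X|:
   sup_{theta < chi} lambda^theta = lambda *)
Definition lt_pow_eq (L X : Type) : Prop :=
  (forall S : Type, card_lt [set: S] [set: X] -> [set: S -> L] #<= [set: L]) /\
  (exists S : Type, card_lt [set: S] [set: X] /\ [set: L] #<= [set: S -> L]).

Definition has_otype (K S : Type) (ltK : K -> K -> Prop) (ltS : S -> S -> Prop)
  (a : set K) : Prop :=
  exists f : S -> K, (forall x y, ltS x y -> ltK (f x) (f y)) /\ a = range f.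

Definition set_below (K : Type) (ltK : K -> K -> Prop) (a b : set K) : Prop :=
  forall x y, a x -> b y -> ltK x y.

Definition pw_disjoint (K : Type) (A : set (set K)) : Prop :=
  forall a b, A a -> A b -> a <> b -> a `&` b = set0.

Definition homog (K M Th : Type) (c : K -> K -> Th) (p : K -> K -> M)
  (tau : M -> Th) (a b : set K) : Prop :=
  forall x y, a x -> b y -> c x y = tau (p x y).

(* c witnesses pr_1(kappa, kappa, theta, chi)_p, kappa = (K,ltK), chi = |X| *)
Definition pr1 (K M Th : Type) (ltK : K -> K -> Prop) (c : K -> K -> Th)
  (p : K -> K -> M) (X : Type) : Prop :=
  forall (S : Type) (ltS : S -> S -> Prop), is_wo ltS ->
  card_lt [set: S] [set: X] ->
  forall A : set (set K),
    (forall a, A a -> has_otype ltK ltS a) -> pw_disjoint A -> A #= [set: K] ->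
  forall tau : M -> Th,
    exists a b, A a /\ A b /\ set_below ltK a b /\ homog c p tau a b.

(* c witnesses pr_1(kappa, nu circledast kappa / nu' circledast kappa, theta, chi)_p,
   nu = |NA|, nu' = |NP| *)
Definition pr1_circ (K M Th : Type) (ltK : K -> K -> Prop) (c : K -> K -> Th)
  (p : K -> K -> M) (X NA NP : Type) : Prop :=
  forall (S : Type) (ltS : S -> S -> Prop), is_wo ltS ->
  card_lt [set: S] [set: X] ->
  forall A B : set (set K),
    (forall a, A a -> has_otype ltK ltS a) ->
    (forall b, B b -> has_otype ltK ltS b) ->
    pw_disjoint A -> pw_disjoint B ->
    A #= [set: NA] -> B #= [set: K] ->
  exists A' : set (set K), A' `<=` A /\ A' #= [set: NP] /\
    forall tau : M -> Th,
      exists a b, A' a /\ B b /\ set_below ltK a b /\ homog c p tau a b.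

(* cf([lambda]^nu, subseteq) <= lambda, lambda = |L|, nu = |N| *)
Definition cf_subsets_le (L N : Type) : Prop :=
  exists F : set (set L), F #<= [set: L] /\ (forall f, F f -> f #= [set: N]) /\
    forall s : set L, s #= [set: N] -> exists f, F f /\ s `<=` f.

(* Main.v *)
Require Import Defs.
From mathcomp Require Import all_boot all_order all_algebra.
From mathcomp Require Import boolp classical_sets functions cardinality.
From Stdlib Require Import Relation_Operators Wellfounded.
Local Open Scope classical_set_scope.
Local Open Scope card_scope.

(* For each b in K = lambda^+ fix a surjection e b from L onto the points <= b,
   and code pairs of elements of L by single elements. If c x y codes (j, z), set
   c+ x y = e (e y (G j y)) z, where (G j) is a family of |L| functions K -> L
   realizing every assignment of values in L to fewer than chi points.
   A function tau : M -> K is bounded by some d, so each tau m is e d z for some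
   z, while d is e y l for some l depending on y. The latter dependence is absorbed
   by G: for every small b above d, some j satisfies e y (G j y) = d for all y in b,
   and |K| members of a family share the same j. On these, c+ realizes tau as soon
   as c realizes m |-> (j, z). In (3) a cofinal family of |L| sets bounds the number
   of candidates for A', so if all of them failed, their counterexamples tau would
   have a common bound d. *)

Set Implicit Arguments.
Unset Strict Implicit.

Local Notation seg lt a := [set b | lt b a].

(** * Cardinal comparison through relations and functions *)

(** A relation that need not be single-valued needs no default values, which spares case
    distinctions on empty sets, as in [card_le_setX]. *)
Lemma card_leE (T U : Type) (A : set T) (B : set U) :
  A #<= B <-> exists R : T -> U -> Prop,
    (forall x, A x -> exists2 y, B y & R x y) /\
    (forall x x' y, A x -> A x' -> R x y -> R x' y -> x = x').
Proof.
split=> [/card_leP[f]|[R [Rtot Rinj]]].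
  exists (fun x y => exists (Ax : x \in A), y = val (f (SigSub Ax))); split.
    move=> x Ax; exists (val (f (SigSub (mem_set Ax)))).
      exact: set_mem (valP (f (SigSub (mem_set Ax)))).
    by exists (mem_set Ax).
  move=> x x' y _ _ [Ax ->] [Ax' /val_inj].
  by move=> /(inj (in_setT _) (in_setT _)) [].
have [->|/set0P[x0 Ax0]] := eqVneq A set0; first exact: card_ge0.
have [y0 By0 _] := Rtot x0 Ax0.
have /choice[f fP] : forall x, exists y, A x -> B y /\ R x y.
  move=> x; have [Ax|nAx] := pselect (A x); last by exists y0.
  by have [y By Rxy] := Rtot x Ax; exists y.
suff: $|{injfun A >-> B}| by case=> g; exact: inj_card_le g.
apply/injfunPex; exists f => [x Ax|x x' /set_mem Ax /set_mem Ax' fxx'].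
  by have [] := fP x Ax.
have [_ Rx] := fP x Ax; have [_ Rx'] := fP x' Ax'.
by apply: (Rinj _ _ (f x)) => //; rewrite fxx'.
Qed.

Lemma inj_on_card_le (T U : Type) (A : set T) (B : set U) (f : T -> U) :
  (forall x, A x -> B (f x)) ->
  (forall x y, A x -> A y -> f x = f y -> x = y) -> A #<= B.
Proof.
move=> fAB finj; apply/card_leE; exists (fun x y => y = f x); split.
  by move=> x Ax; exists (f x) => //; exact: fAB.
by move=> x x' y Ax Ax' -> /finj; apply.
Qed.

Lemma card_le_inj (T U : Type) (u0 : U) (A : set T) (B : set U) :
  A #<= B -> exists f : T -> U,
    (forall x, A x -> B (f x)) /\
    (forall x y, A x -> A y -> f x = f y -> x = y).
Proof.
move=> /card_leE[R [Rtot Rinj]].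
have /choice[f fP] : forall x, exists y, A x -> B y /\ R x y.
  move=> x; have [Ax|nAx] := pselect (A x); last by exists u0.
  by have [y By Rxy] := Rtot x Ax; exists y.
exists f; split=> [x /fP[]//|x y Ax Ay fxy].
have [_ Rx] := fP x Ax; have [_ Ry] := fP y Ay.
by apply: (Rinj _ _ (f x)) => //; rewrite fxy.
Qed.

Lemma surj_on_card_le (T U : Type) (A : set T) (B : set U) (g : U -> T) :
  (forall x, A x -> exists2 y, B y & g y = x) -> A #<= B.
Proof.
move=> gsurj; apply/card_leE; exists (fun x y => g y = x); split=> //.
by move=> x x' y _ _ <- <-.
Qed.

Lemma card_le_surj (T U : Type) (t0 : T) (A : set T) (B : set U) :
  A #<= B -> exists g : U -> T, forall x, A x -> exists2 y, B y & g y = x.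
Proof.
move=> /card_leE[R [Rtot Rinj]].
have /choice[g gP] : forall y, exists x, forall x', A x' -> R x' y -> x = x'.
  move=> y; have [[x [Ax Rxy]]|nR] := pselect (exists x, A x /\ R x y).
    by exists x => x' Ax' Rx'y; apply: Rinj Rxy Rx'y.
  by exists t0 => x' Ax' Rx'y; case: nR; exists x'.
by exists g => x Ax; have [y By Rxy] := Rtot x Ax; exists y => //; apply: gP.
Qed.

Lemma card_le_setX (T U T' U' : Type) (A : set T) (B : set U) (A' : set T')
  (B' : set U') : A #<= A' -> B #<= B' -> A `*` B #<= A' `*` B'.
Proof.
move=> /card_leE[R [Rtot Rinj]] /card_leE[Q [Qtot Qinj]].
apply/card_leE; exists (fun p q => R p.1 q.1 /\ Q p.2 q.2); split.
  move=> [x y] [/= /Rtot[x' Ax' Rx] /Qtot[y' By' Qy]].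
  by exists (x', y').
move=> [x y] [x' y'] [z t] [/= Ax By] [/= Ax' By'] [Rx Qy] [Rx' Qy'].
by rewrite (Rinj _ _ _ Ax Ax' Rx Rx') (Qinj _ _ _ By By' Qy Qy').
Qed.

(** Hilbert's hotel along a copy [g] of the natural numbers in [A]. The guards [y <> x] cover the
    case that [x] already lies in [A]. *)
Lemma card_le_setU1 (T : Type) (A : set T) (x : T) :
  infinite_set A -> A `|` [set x] #<= A.
Proof.
move=> /infiniteP /(card_le_inj x)[g [gA ginj]].
have {}ginj n m : g n = g m -> n = m by exact: ginj.
apply/card_leE; exists (fun y z => (y = x /\ z = g 0%N) \/
  (y <> x /\ exists n, y = g n /\ z = g n.+1) \/
  (y <> x /\ (forall n, y <> g n) /\ z = y)); split.
  move=> y Axy; have [->|yx] := pselect (y = x).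
    by exists (g 0%N); [exact: gA|left].
  have [[n yn]|ng] := pselect (exists n, y = g n).
    by exists (g n.+1); [exact: gA|right; left; split=> //; exists n].
  exists y; first by case: Axy.
  by right; right; do 2!split=> //; move=> n yn; apply: ng; exists n.
move=> y y' z _ _ [[-> ->]|[[yx [n [-> ->]]]|[yx [ng ->]]]].
- by move=> [[-> //]|[[_ [m [_ /ginj]]]|[_ [mg /esym/mg]]]].
- by move=> [[_ /ginj]|[[_ [m [-> /ginj[->]]]]|[_ [mg /esym/mg]]]].
- by move=> [[_ /ng]|[[_ [m [_ /ng]]]|[_ [_ ->]]]].
Qed.

(** * Cardinalities of segments of well-orders *)

(* The injection is built by recursion along [R]: at [w] there is still an
   element of [A] left, since otherwise the predecessors of [w] would cover [A]. *)
Lemma wf_card_le (W T : Type) (R : W -> W -> Prop) (D : set W) (A : set T) :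
  well_founded R ->
  (forall x y, D x -> D y -> x = y \/ R x y \/ R y x) ->
  (forall w, D w -> ~ (A #<= [set v | D v /\ R v w])) -> D #<= A.
Proof.
move=> Rwf Rtot Abig.
have [->|/set0P[w0 Dw0]] := eqVneq D set0; first exact: card_ge0.
have [A0|/set0P[t0 At0]] := eqVneq A set0.
  by case: (Abig w0 Dw0); rewrite A0; exact: card_ge0.
pose P w (rec : forall v, R v w -> T) t :=
  A t /\ forall v (Rvw : R v w), D v -> rec v Rvw <> t.
pose step w (rec : forall v, R v w -> T) : T :=
  if pselect (exists t, P w rec t) is left h then projT1 (cid h) else t0.
pose F := Fix Rwf (fun=> T) step.
have FE w : F w = step w (fun v _ => F v).
  apply: Fix_eq => x f g fg; congr (step x _).
  by apply/functional_extensionality_dep => y; apply/funext => ?; exact: fg.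
have FP w : D w -> A (F w) /\ forall v, R v w -> D v -> F v <> F w.
  move=> Dw; suff h : exists t, P w (fun v _ => F v) t.
    rewrite FE /step; case: pselect => // h'.
    by case: cid => t [At tP]; split=> // v Rvw Dv; exact: tP.
  apply: contrapT => nh; apply: (Abig w Dw).
  apply: (@surj_on_card_le _ _ _ _ F) => t At.
  apply: contrapT => nv; apply: nh; exists t; split=> // v Rvw Dv Fv.
  by apply: nv; exists v.
apply: (@inj_on_card_le _ _ _ _ F) => [w /FP[]//|v w Dv Dw Fvw].
have [//|[Rvw|Rwv]] := Rtot v w Dv Dw.
  by have [_ /(_ v Rvw Dv)] := FP w Dw.
by have [_ /(_ w Rwv Dw)] := FP v Dv; rewrite Fvw.
Qed.

(** If [A] embeds into no segment, the recursion of [wf_card_le] along all of [K] never runs out of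
    values in [A]. *)
Lemma wo_card_le_or (K T : Type) (lt : K -> K -> Prop) (A : set T) :
  is_wo lt -> [set: K] #<= A \/ exists k, A #<= seg lt k.
Proof.
move=> [_ [_ [tot wf]]].
have [h|nh] := pselect (exists k, A #<= seg lt k); [by right|left].
apply: (wf_card_le wf) => [x y _ _|w _ Aw]; first exact: tot.
by apply: nh; exists w; apply: card_le_trans Aw _; apply: subset_card_le => v [].
Qed.

(** Take the least segment into which [A] embeds: by minimality [wf_card_le] embeds it back into
    [A]. *)
Lemma wo_card_eq_seg (K T : Type) (lt : K -> K -> Prop) (A : set T) (k : K) :
  is_wo lt -> A #<= seg lt k ->
  exists k', A #<= seg lt k' /\ seg lt k' #<= A.
Proof.
move=> [irr [trans [tot wf]]]; elim/(well_founded_ind wf): k => k IH Ak.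
have [[k' [k'k Ak']]|nh] := pselect (exists k', lt k' k /\ A #<= seg lt k').
  exact: IH Ak'.
exists k; split=> //; apply: (wf_card_le wf) => [x y _ _|w wk Aw]; first exact: tot.
apply: nh; exists w; split=> //.
by apply: card_le_trans Aw _; apply: subset_card_le => v [].
Qed.

(* Goedel's ordering of pairs, by maximum and then lexicographically: the
   predecessors of a pair lie in the square of the closed segment of its maximum. *)
Lemma wo_seg_square (K : Type) (lt : K -> K -> Prop) (k : K) :
  is_wo lt -> infinite_set (seg lt k) ->
  seg lt k `*` seg lt k #<= seg lt k.
Proof.
move=> [irr [trans [tot wf]]]; elim/(well_founded_ind wf): k => k IH kinf.
(* Either an earlier segment is equally large and the induction hypothesis applies there, or
   [seg lt k] has the order type of an initial ordinal. *)
have [[k' [k'k kk']]|nh] :=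
    pselect (exists k', lt k' k /\ seg lt k #<= seg lt k').
  have k'inf : infinite_set (seg lt k').
    by move=> /(card_le_finite kk').
  apply: card_le_trans (card_le_setX kk' kk') _.
  apply: card_le_trans (IH _ k'k k'inf) _.
  by apply: subset_card_le => x /= /trans; apply.
pose m (p : K * K) := if pselect (lt p.1 p.2) then p.2 else p.1.
have m1 p : p.1 = m p \/ lt p.1 (m p).
  by rewrite /m; case: pselect; [right|left].
have m2 p : p.2 = m p \/ lt p.2 (m p).
  rewrite /m; case: pselect => [|nlt] /=; first by left.
  by have [->|[]] := tot p.1 p.2; [left| |right].
pose R p q := slexprod K (K * K) lt (slexprod K K lt lt) (m p, p) (m q, q).
have Rwf : well_founded R.
  apply: (wf_inverse_image _ _ _ (fun p => (m p, p))).
  exact: (wf_slexprod _ _ _ _ wf (wf_slexprod _ _ _ _ wf wf)).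
have Rm p q : R p q -> m p = m q \/ lt (m p) (m q).
  by move=> Rpq; inversion Rpq; [right|left].
apply: (wf_card_le Rwf) => [p q _ _|p [p1k p2k]].
  rewrite /R; have [mpq|[mpq|mpq]] := tot (m p) (m q); last 2 first.
  - by right; left; apply: left_slex.
  - by right; right; apply: left_slex.
  rewrite mpq; case: p q {mpq} => [x y] [x' y'].
  have [->|[xx'|x'x]] := tot x x'; last 2 first.
  - by right; left; apply/right_slex/left_slex.
  - by right; right; apply/right_slex/left_slex.
  have [->|[yy'|y'y]] := tot y y'; first by left.
  - by right; left; apply/right_slex/right_slex.
  - by right; right; apply/right_slex/right_slex.
have mk : lt (m p) k by rewrite /m; case: pselect.
pose C := seg lt (m p) `|` [set m p].
have sub : [set q | (seg lt k `*` seg lt k) q /\ R q p] `<=` C `*` C.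
  move=> q [_ /Rm mqp]; split.
    have [->|q1] := m1 q; case: mqp => [mqp|mqp].
    - by right.
    - by left.
    - by left; rewrite /= -mqp.
    - by left; exact: trans mqp.
  have [->|q1] := m2 q; case: mqp => [mqp|mqp].
  - by right.
  - by left.
  - by left; rewrite /= -mqp.
  - by left; exact: trans mqp.
move=> /card_le_trans/(_ (subset_card_le sub)) kC.
(* A finite [C] would make [seg lt k] finite; for an infinite one the induction hypothesis at [m p]
   contradicts [nh]. *)
have [mfin|minf] := pselect (finite_set (seg lt (m p))).
  apply: kinf; apply: card_le_finite kC _.
  by apply: finite_setX; rewrite finite_setU; split.
apply: nh; exists (m p); split=> //; apply: card_le_trans kC _.
have Cm : C #<= seg lt (m p) by exact: card_le_setU1.
exact: card_le_trans (card_le_setX Cm Cm) (IH _ mk minf).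
Qed.

(** * Arithmetic and regularity of the successor cardinal *)

Lemma succ_card_le_seg (L K : Type) (lt : K -> K -> Prop) :
  is_succ_card L lt -> exists k, [set: L] #<= seg lt k.
Proof. by move=> [wo [[_ nKL] _]]; have [] := wo_card_le_or [set: L] wo. Qed.

Lemma succ_card_small (L K T : Type) (lt : K -> K -> Prop) (A : set T) :
  is_succ_card L lt -> ~ ([set: K] #<= A) -> A #<= [set: L].
Proof.
move=> [wo [_ segL]] nKA; have [//|[k Ak]] := wo_card_le_or A wo.
exact: card_le_trans Ak (segL k).
Qed.

(** [L] carries no order of its own, so the square is computed in an equinumerous segment of [K]. *)
Lemma succ_card_square (L K : Type) (lt : K -> K -> Prop) :
  infinite_set [set: L] -> is_succ_card L lt ->
  [set: L] `*` [set: L] #<= [set: L].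
Proof.
move=> Linf LK; have [k Lk] := succ_card_le_seg LK.
have [wo [_ segL]] := LK.
have kinf : infinite_set (seg lt k) by move=> /(card_le_finite Lk).
apply: card_le_trans (card_le_setX Lk Lk) _.
exact: card_le_trans (wo_seg_square wo kinf) (segL k).
Qed.

Lemma card_le_prod (I J L : Type) : [set: L] `*` [set: L] #<= [set: L] ->
  [set: I] #<= [set: L] -> [set: J] #<= [set: L] -> [set: I * J] #<= [set: L].
Proof.
move=> sq IL JL; have := card_le_trans (card_le_setX IL JL) sq.
by apply: card_le_trans; apply: subset_card_le.
Qed.

Lemma infinite_two (L : Type) :
  infinite_set [set: L] -> exists l0 l1 : L, l0 <> l1.
Proof.
move=> Linf; have /set0P[l0 _] : [set: L] != set0.
  by apply/eqP => L0; apply: Linf; rewrite L0; exact: finite_set0.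
exists l0; apply: contrapT => nl; apply: Linf.
have -> : [set: L] = [set l0]; last exact: finite_set1.
apply/seteqP; split=> // l _ /=; apply: contrapT => ll0.
by apply: nl; exists l => /esym.
Qed.

(** Closed segments are never empty, so a surjection from [L] exists even at the least point. *)
Lemma succ_enum (L K : Type) (lt : K -> K -> Prop) :
  infinite_set [set: L] -> is_succ_card L lt ->
  exists e : K -> L -> K, forall a b, a = b \/ lt a b -> exists l, e b l = a.
Proof.
move=> Linf [wo [_ segL]].
have /choice[e eP] : forall b, exists g : L -> K,
    forall a, a = b \/ lt a b -> exists l, g l = a.
  move=> b; suff CL : seg lt b `|` [set b] #<= [set: L].
    have [g gP] := card_le_surj b CL; exists g => a ab.
    by have [|l _ gl] := gP a; [case: ab; [right|left]|exists l].
  have [bfin|binf] := pselect (finite_set (seg lt b)); last first.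
    exact: card_le_trans (card_le_setU1 _ binf) (segL b).
  have /finite_setP[n bn] : finite_set (seg lt b `|` [set b]).
    by rewrite finite_setU; split.
  rewrite (card_le_eql bn); move/infiniteP: Linf; apply: card_le_trans.
  exact: card_leT.
by exists e => a b; apply: eP.
Qed.

(** Regularity: the closed segments of an unbounded family would cover [K] by the image of
    [I * L]. *)
Lemma succ_bounded (L K I : Type) (lt : K -> K -> Prop) (tau : I -> K) :
  infinite_set [set: L] -> is_succ_card L lt -> [set: I] #<= [set: L] ->
  exists d, forall i, tau i = d \/ lt (tau i) d.
Proof.
move=> Linf LK IL; have [e eP] := succ_enum Linf LK.
have [wo [[_ nKL] _]] := LK; have [_ [_ [tot _]]] := wo.
apply: contrapT => unb; apply: nKL.
apply: card_le_trans (card_le_prod (succ_card_square Linf LK) IL (card_lexx _)).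
apply: (@surj_on_card_le _ _ _ _ (fun q : I * L => e (tau q.1) q.2)) => d _.
have [i id] : exists i, ~ (tau i = d \/ lt (tau i) d).
  apply: contrapT => nd; apply: unb; exists d => i.
  by apply: contrapT => id; apply: nd; exists i.
have [|l el] := eP d (tau i); last by exists (i, l).
by have [?|[?|?]] := tot (tau i) d; [case: id; left|case: id; right|right].
Qed.

(** If all fibres were small, surjections from [L] onto them would combine into one from [I * L]
    onto [B]. *)
Lemma succ_pigeonhole (L K T I : Type) (lt : K -> K -> Prop) (B : set T)
    (q : T -> I) :
  infinite_set [set: L] -> is_succ_card L lt -> [set: I] #<= [set: L] ->
  [set: K] #<= B -> exists i, [set: K] #<= [set b | B b /\ q b = i].
Proof.
move=> Linf LK IL KB; have [wo [[_ nKL] _]] := LK.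
have [b0 Bb0] : B !=set0.
  apply/set0P/eqP => B0; apply: nKL; apply: card_le_trans KB _.
  by rewrite B0; exact: card_ge0.
apply: contrapT => nfib; apply: nKL; apply: card_le_trans KB _.
have /choice[g gP] : forall i, exists g : L -> T,
    forall b, B b -> q b = i -> exists l, g l = b.
  move=> i; have /(card_le_surj b0)[g gP] :
      [set b | B b /\ q b = i] #<= [set: L].
    by apply: (succ_card_small LK) => Ki; apply: nfib; exists i.
  by exists g => b Bb qb; have [|l _ gl] := gP b; [|exists l].
apply: card_le_trans (card_le_prod (succ_card_square Linf LK) IL (card_lexx _)).
apply: (@surj_on_card_le _ _ _ _ (fun z : I * L => g z.1 z.2)) => b Bb.
by have [l gl] := gP _ b Bb erefl; exists (q b, l).
Qed.

(* Diagonalization: [r b] is made to differ from every earlier [r a] at an index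
   [l] with [e b l = a]. *)
Lemma succ_separating (L K : Type) (lt : K -> K -> Prop) :
  infinite_set [set: L] -> is_succ_card L lt ->
  exists r : K -> L -> L, forall a b, a <> b -> exists l, r a l <> r b l.
Proof.
move=> Linf LK; have [e eP] := succ_enum Linf LK.
have [l0 [l1 l01]] := infinite_two Linf.
have [[irr [_ [tot wf]]] _] := LK.
pose step b (rec : forall a, lt a b -> L -> L) l :=
  if pselect (lt (e b l) b) is left h then
    if pselect (rec _ h l = l0) then l1 else l0
  else l0.
pose r := Fix wf (fun=> L -> L) step.
have rE b : r b = step b (fun a _ => r a).
  apply: Fix_eq => x f g fg; congr (step x _).
  by apply/functional_extensionality_dep => y; apply/funext => ?; exact: fg.
have sep a b : lt a b -> exists l, r a l <> r b l.
  move=> ab; have [|l el] := eP a b; first by right.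
  exists l; rewrite (rE b) /step; case: pselect; rewrite el // => _.
  by case: pselect => /= [->//|//].
exists r => a b; have [//|[/sep//|/sep[l rl] _]] := tot a b.
by exists l => /esym.
Qed.

(** * Coding of small functions and uniformization *)

Lemma card_le_exp (T U L : Type) (l : L) :
  [set: T] #<= [set: U] -> [set: T -> L] #<= [set: U -> L].
Proof.
have [[t0 _]|nT] := pselect ([set: T] !=set0).
  move=> /(card_le_surj t0)[g gP].
  apply: (@inj_on_card_le _ _ _ _ (fun (phi : T -> L) u => phi (g u))) => // phi psi _ _ pg.
  apply/funext => t; have [u _ <-] := gP t I.
  exact: (congr1 (@^~ u) pg).
move=> _; apply: (@inj_on_card_le _ _ _ _ (fun=> fun=> l)) => // f g _ _ _.
by apply/funext => t; case: nT; exists t.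
Qed.

(** Cantor's diagonal argument. *)
Lemma card_exp_gt (L : Type) (l0 l1 : L) :
  l0 <> l1 -> ~ ([set: L -> L] #<= [set: L]).
Proof.
move=> l01 /(card_le_surj (fun=> l0))[g gP].
pose phi l := if pselect (g l l = l0) then l1 else l0.
have [l _ /(congr1 (@^~ l))] := gP phi I.
by rewrite /phi; case: pselect => /= [->//|//].
Qed.

Lemma card_le_of_exp (S L : Type) (l0 l1 : L) : l0 <> l1 ->
  [set: S -> L] #<= [set: L] -> [set: S] #<= [set: L].
Proof.
move=> l01; apply: card_le_trans.
pose chi (s t : S) := if pselect (s = t) then l1 else l0.
apply: (@inj_on_card_le _ _ _ _ chi) => // s t _ _ /(congr1 (@^~ s)).
rewrite /chi; case: pselect => //= _; case: pselect => /= [->//|_].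
by move=> /esym.
Qed.

(** [D] is a decoder: one element of [L] stores a whole function on the segment. Nesting it stores
    functions of several arguments. *)
Lemma seg_coding (L K : Type) (lt : K -> K -> Prop) (l0 : L) (k : K) :
  [set: {x | lt x k} -> L] #<= [set: L] ->
  exists D : L -> K -> L,
    forall phi : K -> L, exists l, forall x, lt x k -> D l x = phi x.
Proof.
move=> /(card_le_surj (fun=> l0))[g gP].
exists (fun l x => if pselect (lt x k) is left h then g l (exist _ x h) else l0).
move=> phi; have [l _ gl] := gP (fun z => phi (sval z)) I; exists l => x xk.
by case: pselect => // h; rewrite gl.
Qed.

(* A restricted Engelking-Karlowicz theorem: fewer than chi points of K carry
   prescribed values in L under one of |L| functions, namely the functions coded
   by a segment [seg k] enumerating the points, indices [d s t] separating the
   s-th point from the t-th one, the traces of the points on these indices, and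
   the values. *)
Lemma succ_uniformize (L K : Type) (lt : K -> K -> Prop) :
  infinite_set [set: L] -> is_succ_card L lt ->
  exists G : L -> K -> L, forall S : Type, [set: S -> L] #<= [set: L] ->
    forall (f : S -> K) (h : S -> L), (forall s t, f s = f t -> s = t) ->
    exists j, forall s, G j (f s) = h s.
Proof.
move=> Linf LK; have [l0 [l1 l01]] := infinite_two Linf.
(* The segments needed end at or below [k0], so [e k0] names them by elements of [L]. *)
have [k0 Lk0] := succ_card_le_seg LK.
have [e eP] := succ_enum Linf LK.
have [r rP] := succ_separating Linf LK.
have [wo [_ segL]] := LK; have [irr [trans [tot wf]]] := wo.
have sq := succ_card_square Linf LK.
have [pi piP] : exists pi : L -> L * L * (L * L), forall q, exists l, pi l = q.
  have [] := @card_le_surj _ _ (l0, l0, (l0, l0)) [set: L * L * (L * L)] [set: L].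
    by do 3!apply: (card_le_prod sq) => //.
  by move=> pi piP; exists pi => q; have [l _ <-] := piP q I; exists l.
pose good k := [set: {x | lt x k} -> L] #<= [set: L].
pose codes k (D : L -> K -> L) := good k ->
  forall phi : K -> L, exists l, forall x, lt x k -> D l x = phi x.
have /(@choice _ _ codes)[D DP] : forall k, exists D, codes k D.
  move=> k; have [/(@seg_coding L K lt l0 k)[D DP]|nk] := pselect (good k).
    by exists D.
  by exists (fun=> fun=> l0) => /nk.
(* Here [i] names the segment, [la] stores the separating indices, [lb] the traces of the enumerated
   points at them, and [lc] the values. [Q j b u] says that [b] has the traces recorded for position
   [u]. *)
pose Q j b u := let: ((i, la), (lb, lc)) := pi j in let k := e k0 i in
  lt u k /\ forall s t, lt s k -> lt t k ->
    r b (D k (D k la s) t) = D k (D k (D k lb s) t) u.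
pose V j u := let: ((i, la), (lb, lc)) := pi j in D (e k0 i) lc u.
exists (fun j b =>
  if pselect (exists u, Q j b u) is left h then V j (projT1 (cid h)) else l0).
move=> S SL f h finj.
have [[s0 _]|nS] := pselect ([set: S] !=set0); last first.
  by exists l0 => s; case: nS; exists s.
have Sk0 := card_le_trans (card_le_of_exp l01 SL) Lk0.
have [k [Sk kS]] := wo_card_eq_seg wo Sk0.
(* If [k0] were below [k], [L] would embed into [S], hence [L -> L] into [L]. *)
have kk0 : k = k0 \/ lt k k0.
  have [|[|k0k]] := tot k k0; [by left|by right|].
  case: (card_exp_gt l01); apply: card_le_trans SL; apply: card_le_exp => //.
  apply: card_le_trans (card_le_trans Lk0 _) kS.
  by apply: subset_card_le => x /= /trans; apply.
have kgood : good k.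
  apply: card_le_trans SL; apply: card_le_exp => //; apply: card_le_trans kS.
  apply: (@inj_on_card_le _ _ _ _ sval) => [[]//|[x xk] [y yk] _ _ /= xy].
  exact: eq_exist.
have {}DP := DP k kgood.
have [u [uk uinj]] := card_le_inj k Sk.
have /choice[g gP] : forall x, exists s, forall t, u t = x -> t = s.
  move=> x; have [[s sx]|ns] := pselect (exists s, u s = x).
    by exists s => t tx; apply: uinj => //; rewrite tx.
  by exists s0 => t tx; case: ns; exists t.
have guK s : g (u s) = s by apply/esym/gP.
have /choice[d dP] : forall q : K * K, exists l, f (g q.1) <> f (g q.2) ->
    r (f (g q.1)) l <> r (f (g q.2)) l.
  move=> q; have [/rP[l rl]|nq] := pselect (f (g q.1) <> f (g q.2)).
    by exists l.
  by exists l0 => /nq.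
have [lc lcP] := DP (h \o g).
have [la laP] : exists la, forall s t, lt s k -> lt t k ->
    D k (D k la s) t = d (s, t).
  have /choice[m mP] := fun s => DP (fun t => d (s, t)).
  have [la laP] := DP m; exists la => s t sk tk.
  by rewrite laP// mP.
have [lb lbP] : exists lb, forall s t x, lt s k -> lt t k -> lt x k ->
    D k (D k (D k lb s) t) x = r (f (g x)) (d (s, t)).
  have /choice[m mP] := fun q => DP (fun x => r (f (g x)) (d q)).
  have /choice[n nP] := fun s => DP (fun t => m (s, t)).
  have [lb lbP] := DP n; exists lb => s t x sk tk xk.
  by rewrite lbP// nP// mP.
have [i ik] := eP _ _ kk0.
have [j jP] := piP (i, la, (lb, lc)).
exists j => s.
case: pselect => [hu|nu]; last first.
  case: nu; exists (u s); rewrite /Q jP ik; split; first exact: uk.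
  by move=> s' t' sk' tk'; rewrite laP// lbP ?guK//; exact: uk.
case: cid => x /=; rewrite /Q /V jP ik => -[xk xP].
(* The chosen [x] may differ from [u s], but [f (g x)] is [f s]: otherwise the index [d (u s, x)]
   would separate them, whereas [Q] makes their traces agree there. *)
rewrite lcP//=; congr h; apply: finj; apply: contrapT => fgx.
have usk : lt (u s) k by exact: uk.
have := dP (u s, x); rewrite /= guK => /(_ (fun E => fgx (esym E))); apply.
by rewrite -lbP// -xP// laP.
Qed.

(** * Thinning out disjoint families *)

Lemma otype_enum_inj (K S : Type) (ltK : K -> K -> Prop) (ltS : S -> S -> Prop)
    (f : S -> K) :
  is_wo ltK -> is_wo ltS -> (forall x y, ltS x y -> ltK (f x) (f y)) ->
  forall x y, f x = f y -> x = y.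
Proof.
move=> [irr _] [_ [_ [tot _]]] fmono x y fxy.
by have [//|[/fmono|/fmono]] := tot x y; rewrite fxy => /irr.
Qed.

(* By disjointness at most |L| members of [B] have an element below [d]; the
   others are colored by their code [j]. *)
Lemma stabilize_family (L K S : Type) (lt : K -> K -> Prop)
    (ltS : S -> S -> Prop) (e : K -> L -> K) (G : L -> K -> L)
    (B : set (set K)) (d : K) :
  infinite_set [set: L] -> is_succ_card L lt ->
  (forall a b, a = b \/ lt a b -> exists l, e b l = a) ->
  (forall (f : S -> K) (h : S -> L), (forall s t, f s = f t -> s = t) ->
    exists j, forall s, G j (f s) = h s) ->
  is_wo ltS -> (forall b, B b -> has_otype lt ltS b) -> pw_disjoint B ->
  B #= [set: K] ->
  exists j B', B' `<=` B /\ B' #= [set: K] /\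
    forall b y, B' b -> b y -> e y (G j y) = d.
Proof.
move=> Linf LK eP GP woS Bot Bdisj BK.
have [wo [[_ nKL] segL]] := LK; have [_ [_ [tot _]]] := wo.
have [l0 [l1 l01]] := infinite_two Linf.
move/card_eqPle : BK => [BleK KleB].
(* The flag [q.1] records whether [b] lies entirely at or above [d]; only then is [q.2]
   meaningful. *)
pose coded b (q : bool * L) := B b ->
  if q.1 then forall y, b y -> e y (G q.2 y) = d else exists2 y, b y & lt y d.
have /(@choice _ _ coded)[q qP] : forall b, exists q, coded b q.
  move=> b; have [Bb|nBb] := pselect (B b); last by exists (true, l0) => /nBb.
  have [low|high] := pselect (exists2 y, b y & lt y d); first by exists (false, l0).
  have [f [fmono bf]] := Bot b Bb.
  have /choice[h hP] : forall s, exists l, e (f s) l = d.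
    move=> s; apply: eP; have [|[|fsd]] := tot d (f s); [by left|by right|].
    by case: high; exists (f s) => //; rewrite bf; exists s.
  have [j jP] := GP f h (otype_enum_inj wo woS fmono).
  by exists (true, j) => _ y /=; rewrite bf => -[s _ <-]; rewrite jP.
have boolL : [set: bool] #<= [set: L].
  apply: (@inj_on_card_le _ _ _ _ (fun t : bool => if t then l0 else l1)) => //.
  by move=> [] [] _ _ //= E; case: l01.
have [[[] j] fibK] := succ_pigeonhole q Linf LK
    (card_le_prod (succ_card_square Linf LK) boolL (card_lexx _)) KleB.
  exists j, [set b | B b /\ q b = (true, j)]; split; first by move=> b [].
  split=> [|b y [Bb qb]]; last by have := qP b Bb; rewrite qb => /(_ y).
  apply/card_eqPle; split=> //; apply: card_le_trans BleK.
  by apply: subset_card_le => b [].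
case: nKL; apply: card_le_trans fibK _; apply: card_le_trans (segL d).
pose low b y := B b -> (exists2 y, b y & lt y d) -> b y /\ lt y d.
have /(@choice _ _ low)[g gP] : forall b, exists y, low b y.
  move=> b; have [[y yb yd]|nl] := pselect (exists2 y, b y & lt y d).
    by exists y.
  by exists d => _ /nl.
have {}gP b : [set b | B b /\ q b = (false, j)] b -> b (g b) /\ lt (g b) d.
  by move=> [Bb qb]; have := qP b Bb; rewrite qb => /(gP _ Bb).
apply: (@inj_on_card_le _ _ _ _ g) => [b /gP[]//|b b' Fb Fb' gbb'].
have [bg _] := gP b Fb; have [b'g _] := gP b' Fb'.
apply: contrapT => bb'; have : (b `&` b') (g b) by split=> //; rewrite gbb'.
by rewrite (Bdisj b b')//; [case: Fb|case: Fb'].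
Qed.

(** * Stepping up from [L] to [K] colors *)

Unset Implicit Arguments.
Set Strict Implicit.

Theorem theorem3p4 :
  forall (L K : Type) (ltK : K -> K -> Prop),
    infinite_set [set: L] -> is_succ_card L ltK ->
  forall c : K -> K -> L,
  exists cplus : K -> K -> K,
  forall (M : Type), [set: M] #<= [set: L] ->
  forall p : K -> K -> M,
  forall X : Type, lt_pow_eq L X ->
    (pr1 ltK c p X -> pr1 ltK cplus p X) /\
    (pr1_circ ltK c p X K K -> pr1_circ ltK cplus p X K K) /\
    (forall N : Type, cf_subsets_le L N ->
       pr1_circ ltK c p X L N -> pr1_circ ltK cplus p X L N).
Proof.
move=> L K lt Linf LK c.
have [e eP] := succ_enum Linf LK.
have [G GP] := succ_uniformize Linf LK.
have sq := succ_card_square Linf LK.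
have [l0 _] := infinite_two Linf.
have [pi piP] : exists pi : L -> L * L, forall q, exists l, pi l = q.
  have [|pi piP] := @card_le_surj _ _ (l0, l0) [set: L * L] [set: L].
    exact: card_le_prod.
  by exists pi => q; have [l _ <-] := piP q I; exists l.
exists (fun x y => e (e y (G (pi (c x y)).1 y)) (pi (c x y)).2).
set cplus := fun x y => _.
move=> M ML p X [powL _].
have stab (S : Type) (ltS : S -> S -> Prop) : is_wo ltS -> card_lt [set: S] [set: X] ->
    forall B, (forall b, B b -> has_otype lt ltS b) -> pw_disjoint B ->
    B #= [set: K] -> forall d, exists j B', B' `<=` B /\ B' #= [set: K] /\
      forall b y, B' b -> b y -> e y (G j y) = d.
  move=> woS SX B Bot Bdisj BK d.
  exact: (stabilize_family d Linf LK eP (GP S (powL S SX)) woS Bot Bdisj BK).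
have lift d j (tau : M -> K) : (forall m, tau m = d \/ lt (tau m) d) ->
    exists tau' : M -> L, forall a b : set K,
      (forall y, b y -> e y (G j y) = d) ->
      homog c p tau' a b -> homog cplus p tau a b.
  move=> taud; have /choice[tau' tauP] : forall m, exists l,
      (pi l).1 = j /\ e d (pi l).2 = tau m.
    move=> m; have [z ez] := eP _ _ (taud m).
    by have [l lz] := piP (j, z); exists l; rewrite lz.
  exists tau' => a b bd hom x y ax yb; rewrite /cplus (hom x y ax yb).
  by have [-> <-] := tauP (p x y); rewrite (bd y yb).
split; [|split].
- move=> cpr S ltS woS SX A Aot Adisj AK tau.
  have [d taud] := succ_bounded tau Linf LK ML.
  have [j [A' [A'A [A'K A'd]]]] := stab S ltS woS SX A Aot Adisj AK d.
  have [tau' tauP] := lift d j tau taud.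
  have A'disj : pw_disjoint A' by move=> a b /A'A ? /A'A ?; exact: Adisj.
  have [a [b [Aa [Ab [ab hom]]]]] :=
    cpr S ltS woS SX A' (fun a Aa => Aot a (A'A a Aa)) A'disj A'K tau'.
  exists a, b; split; [exact: A'A|split; [exact: A'A|split=> //]].
  by apply: tauP hom => y; exact: A'd.
- move=> cpr S ltS woS SX A B Aot Bot Adisj Bdisj AK BK.
  (* The subfamily supplied by [c] depends on [tau] through [B'], but [A] itself already has the
     required size. *)
  exists A; split=> //; split=> // tau.
  have [d taud] := succ_bounded tau Linf LK ML.
  have [j [B' [B'B [B'K B'd]]]] := stab S ltS woS SX B Bot Bdisj BK d.
  have [tau' tauP] := lift d j tau taud.
  have B'disj : pw_disjoint B' by move=> a b /B'B ? /B'B ?; exact: Bdisj.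
  have [A' [A'A [_ /(_ tau')[a [b [Aa [Bb [ab hom]]]]]]]] :=
    cpr S ltS woS SX A B' Aot (fun b Bb => Bot b (B'B b Bb)) Adisj B'disj AK B'K.
  exists a, b; split; [exact: A'A|split; [exact: B'B|split=> //]].
  by apply: tauP hom => y; exact: B'd.
- move=> N [F [FL [FN Fcof]]] cpr S ltS woS SX A B Aot Bot Adisj Bdisj AL BK.
  have [v [vA vinj vsurj]] : exists v : L -> set K, set_bij setT A v.
    by apply/card_set_bijP; rewrite card_eq_sym.
  have {}vinj : forall s : set L, {in s &, injective v}.
    by move=> s x y _ _; apply: vinj; rewrite in_setT.
  (* If no [v @` f] works, a single [d] bounds the witnesses of all failures. *)
  apply: contrapT => nA'.
  pose bad f (tau : M -> K) := F f -> ~ exists a b, (v @` f) a /\ B b /\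
    set_below lt a b /\ homog cplus p tau a b.
  have /(@choice _ _ bad)[tau tauF] : forall f, exists tau, bad f tau.
    move=> f; apply: contrapT => ntau; apply: nA'; exists (v @` f).
    have Ff : F f.
      apply: contrapT => nFf; apply: ntau.
      have [k _] := succ_card_le_seg LK.
      by exists (fun=> k) => /nFf.
    split; first by move=> _ [l _ <-]; exact: vA.
    split.
      exact: card_eq_trans (inj_card_eq (vinj f)) (FN f Ff).
    move=> tau; apply: contrapT => ntau'; apply: ntau.
    by exists tau => _.
  (* The values of all the counterexamples together are indexed by [F] times [M], which is small
     enough for a common bound. *)
  have FML : [set: set_type F * M] #<= [set: L].
    by apply: card_le_prod => //; rewrite (card_le_eql (card_setT F)).
  have [d taud] := succ_bounded (fun q : set_type F * M => tau (val q.1) q.2)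
    Linf LK FML.
  have [j [B' [B'B [B'K B'd]]]] := stab S ltS woS SX B Bot Bdisj BK d.
  have B'disj : pw_disjoint B' by move=> a b /B'B ? /B'B ?; exact: Bdisj.
  have [A' [A'A [A'N A'P]]] :=
    cpr S ltS woS SX A B' Aot (fun b Bb => Bot b (B'B b Bb)) Adisj B'disj AL B'K.
  have vA' : v @` (v @^-1` A') = A'.
    apply/seteqP; split=> [_ [l A'l <-]//|a A'a].
    by have [l _ la] := vsurj a (A'A a A'a); exists l => //=; rewrite la.
  (* Cofinality puts the indices of [A'] inside some [f], so a good pair for [A'] refutes the
     counterexample [tau f]. *)
  have [f [Ff A'f]] : exists f, F f /\ v @^-1` A' `<=` f.
    apply: Fcof; rewrite -(card_eqr A'N) -{2}vA' card_eq_sym.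
    exact: inj_card_eq (vinj _).
  have [tau' tauP] := lift d j (tau f) (fun m => taud (SigSub (mem_set Ff), m)).
  apply: (tauF f Ff).
  have [a [b [Aa [Bb [ab hom]]]]] := A'P tau'.
  exists a, b; split.
    have [l _ la] := vsurj a (A'A a Aa); exists l => //.
    by apply: A'f; rewrite /preimage /= la.
  split; [exact: B'B|split=> //].
  by apply: tauP hom => y; exact: B'd.
Qed.
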